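(* Let $S$ and $T$ be groupoids with $[S]\cong[T]$. Suppose that $S$ has an identity element $1$ and that, for $x\in S$, $x^2=1$ implies $x=1$. Then $S\cong T$.
   Context: A groupoid is a set with a binary operation, written as juxtaposition; an identity element is a two-sided identity. For a groupoid $S$, $[S]$ denotes the set $S$ with its natural ternary operation $[abc]=(ab)c$. $[S]\cong[T]$ means that there is a bijection $\delta:S\to T$ with $\delta[abc]=[(\delta a)(\delta b)(\delta c)]$ for all $a,b,c\in S$. *)

(* Defs.v *)
From HB Require Import structures.
From mathcomp Require Import all_boot.
Set Implicit Arguments.
Unset Strict Implicit.
Unset Printing Implicit Defensive.
Local Open Scope group_scope.

(* A groupoid (set with a binary operation) is a [magmaType]; this structure
   imposes no axiom and no choice or decidable equality on the carrier. *)

Definition ternary (S : magmaType) (a b c : S) : S := (a * b) * c.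

Definition ternary_isomorphic (S T : magmaType) : Prop :=
  exists2 f : S -> T, bijective f &
    forall a b c : S, f (ternary a b c) = ternary (f a) (f b) (f c).

Definition magma_isomorphic (S T : magmaType) : Prop :=
  exists2 f : S -> T, bijective f & {morph f : x y / x * y}.

Definition is_identity (S : magmaType) (e : S) : Prop :=
  left_id e (@mul S) /\ right_id e (@mul S).

(* Main.v *)
(* Any isomorphism of the ternary structures is already multiplicative.  The
   square of [f e] is a left identity of [T]; if [a] is its preimage, then
   [f y * f z = (f a * f y) * f z = f ((a * y) * z)].  Taking [y = a] and
   [z = e] gives [a * a = e], so that [a = e]. *)

Require Import Defs.
From HB Require Import structures.
From mathcomp Require Import all_boot.
Set Implicit Arguments.
Unset Strict Implicit.
Unset Printing Implicit Defensive.
Local Open Scope group_scope.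

Theorem theorem8 (S T : magmaType) (hST : ternary_isomorphic S T)
    (e : S) (he : is_identity e)
    (hsq : forall x : S, x * x = e -> x = e) :
  magma_isomorphic S T.
Proof.
case: hST => f f_bij f3; have f_inj := bij_inj f_bij; case: he => mul1e mule1.
exists f => //; case: f_bij => g _ gK.
pose a := g (f e * f e).
have fa_left_id z : f a * f z = f z.
  (* Since [f a] is [f e * f e], the left side is the ternary product of the images of [e], [e],
     [z], and [f3] pulls it back to [e * e * z]. *)
  by rewrite gK -[LHS]/(ternary _ _ _) -f3 /ternary !mul1e.
have fM y z : f y * f z = f (a * y * z).
  (* Inserting the left identity [f a] turns a binary product into a ternary one, to which [f3]
     applies. *)
  by rewrite -{1}[f y]fa_left_id -[LHS]/(ternary _ _ _) -f3.
have a_eq : a = e.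
  (* Padding [a * a] with [e] on the right gives the shape that [fM] reads backwards, leaving
     [f a * f e = f e]. *)
  by apply: hsq; apply: f_inj; rewrite -[a * a]mule1 -fM fa_left_id.
by move=> y z; rewrite fM a_eq mul1e.
Qed.
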